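(* Let $d\ge3$ and $2\le n\le d+1$ be integers with $2n-1<d$, and let $\widetilde B_n^d$ be the smooth projective toric $d$-fold defined in the context. Then $\mathrm{Nef}(\widetilde B_n^d)$ is unimodular with respect to $\mathrm{Pic}(\widetilde B_n^d)$. Consequently, $\delta_{\widetilde B_n^d}(D)=0$ for every nonzero nef integral divisor $D$. In particular, $$\tau_{\widetilde B_n^d}(\mathbb Z)=\tau_{\widetilde B_n^d}(\mathbb Q)=d+1.$$
   Context: All toric varieties are over an algebraically closed field. Gongyo indices. For a smooth projective toric variety $X$, a nonzero class $D\in\mathrm{Nef}(X)\cap\mathrm{Pic}(X)$ and $\mathbb K\in\{\mathbb Z,\mathbb Q\}$, put $$\tau_X(D;\mathbb K)=\sup\Big\{\sum_{i=1}^r a_i\ \Big|\ D=\sum_{i=1}^r a_iD_i,\ 0\ne D_i\in\mathrm{Nef}(X)\cap\mathrm{Pic}(X),\ a_i\in\mathbb K_{>0}\Big\}$$ (for $\mathbb K=\mathbb Q$ the equality is in $\mathrm{Pic}(X)\otimes\mathbb Q$), and $\delta_X(D)=\tau_X(D;\mathbb Q)-\tau_X(D;\mathbb Z)$. If $-K_X$ is nef and nonzero, $\tau_X(\mathbb K):=\tau_X(-K_X;\mathbb K)$. A full-dimensional strongly convex rational polyhedral cone $C\subset L_{\mathbb R}$, $L$ a lattice, is unimodular with respect to $L$ if its primitive extremal-ray generators form a $\mathbb Z$-basis of $L$. The model $\widetilde B^d_n$ for $2n-1<d$. Let $N\simeq\mathbb Z^d$ and $x_1,\dots,x_{d+1}\in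 N$ with $x_1,\dots,x_d$ a basis and $x_1+\cdots+x_{d+1}=0$; put $y_i=-x_i$ ($1\le i\le n$). $\widetilde B_n^d$ is the smooth projective toric $d$-fold whose fan has primitive ray generators $x_1,\dots,x_{d+1},y_1,\dots,y_n$ and whose primitive collections (minimal sets of ray generators not spanning a cone) are exactly $\{x_i,y_i\}$ ($1\le i\le n$) and $\{x_{n+1},\dots,x_{d+1}\}$, with primitive relations $x_i+y_i=0$ and $x_{n+1}+\cdots+x_{d+1}=y_1+\cdots+y_n$. A set of ray generators spans a cone iff it contains none of these collections. *)

(* Defs.v *)
From HB Require Import structures.
From mathcomp Require Import all_boot all_order all_algebra generic_quotient ring_quotient.
From mathcomp Require Import boolp classical_sets reals constructive_ereal ereal.
From mathcomp Require Import zify ring lra.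

Set Implicit Arguments.
Unset Strict Implicit.
Unset Printing Implicit Defensive.

Import Order.TTheory GRing.Theory Num.Theory.

Local Open Scope ring_scope.

(* Toric varieties are represented by their fans in N = Z^d.  For a smooth
   complete toric variety over an algebraically closed field, Pic(X), Nef(X)
   and K_X are given by the combinatorial recipes below, which do not depend
   on the base field; the base field is therefore not mentioned. *)

(* An [e : I -> L] is a Z-basis of L if every element of L is a unique
   integral combination of the e i. *)
Definition Z_basis (L : zmodType) (I : finType) (e : I -> L) : Prop :=
  forall v : L, exists! c : {ffun I -> int}, v = \sum_i e i *~ c i.

Section Unimodular.
(* A lattice L, the real vector space V = L (x) R, the canonical map L -> V,
   and a cone C in V. *)
Variables (R : realType) (L : zmodType) (V : lmodType R) (iota : L -> V).
Variable C : set V.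

Definition rational_polyhedral : Prop :=
  exists (k : nat) (g : 'I_k -> L),
    C = [set v | exists2 t : 'I_k -> R,
           forall i, 0 <= t i & v = \sum_i t i *: iota (g i)]%classic.

Definition full_dimensional : Prop :=
  forall v : V, exists (k : nat) (g : 'I_k -> V) (t : 'I_k -> R),
    (forall i, C (g i)) /\ v = \sum_i t i *: g i.

Definition strongly_convex : Prop := forall v : V, C v -> C (- v) -> v = 0.

Definition extremal_ray (v : V) : Prop :=
  [/\ C v, v != 0 & forall u w, C u -> C w -> u + w = v ->
        exists2 t : R, 0 <= t & u = t *: v].

Definition primitive_vector (v : L) : Prop :=
  forall (w : L) (k : nat), v = w *+ k -> k = 1%N.

Definition primitive_ray_generator (v : L) : Prop :=
  extremal_ray (iota v) /\ primitive_vector v.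

Definition unimodular : Prop :=
  [/\ rational_polyhedral, full_dimensional, strongly_convex &
      exists (r : nat) (g : 'I_r -> L),
        [/\ injective g,
            forall v, primitive_ray_generator v <-> exists i, g i = v &
            Z_basis g]].

End Unimodular.

(* A cone is recorded by the set of its ray generators. *)
Record fan (d : nat) := Fan {
  ray : finType;
  gen : ray -> 'rV[int]_d;
  cones : {set {set ray}} }.

Section FanTheory.
Variables (d : nat) (X : fan d).

Definition genK (K : pzRingType) (rho : ray X) : 'rV[K]_d :=
  map_mx intr (gen rho).

Definition cone_span (R : realType) (s : {set ray X}) : set 'rV[R]_d :=
  [set u | exists c : ray X -> R,
     [/\ forall rho, 0 <= c rho,
         forall rho, rho \notin s -> c rho = 0 &
         u = \sum_rho c rho *: genK R rho]]%classic.
#[local] Arguments cone_span R s u : clear implicits.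

(* [curve_class b] : there is a wall t = s1 :&: s2, with s1 = rho1 |: t and
   s2 = rho2 |: t maximal (d-dimensional) cones, such that
     v_rho1 + v_rho2 + \sum_(rho in t) b_rho v_rho = 0.
   In the smooth complete case this says that b_rho = D_rho . V(t) for all
   rho, where V(t) is the torus-invariant curve of the wall t. *)
Definition curve_class (b : {ffun ray X -> int}) : Prop :=
  exists (t : {set ray X}) (rho1 rho2 : ray X),
    [/\ [/\ rho1 \notin t, rho2 \notin t & rho1 != rho2],
        [/\ rho1 |: t \in cones X, rho2 |: t \in cones X & #|t|.+1 = d],
        [/\ b rho1 = 1, b rho2 = 1 &
            forall rho, rho \notin rho1 |: (rho2 |: t) -> b rho = 0] &
        \sum_rho gen rho *~ b rho = 0].

(* The fan of a smooth projective toric d-fold.  Projectivity is the existence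
   of an ample divisor \sum_rho a_rho D_rho, ampleness being positivity on the
   torus-invariant curves (toric Kleiman criterion). *)
Record smooth_projective (R : realType) : Prop := SmoothProjective {
  cones_closed : forall s t : {set ray X},
    s \in cones X -> t \subset s -> t \in cones X;
  cones_ray : forall rho : ray X, [set rho] \in cones X;
  cones_meet : forall s t : {set ray X}, s \in cones X -> t \in cones X ->
    (cone_span R s `&` cone_span R t `<=` cone_span R (s :&: t))%classic;
  cones_complete : forall u : 'rV[R]_d, exists2 s, s \in cones X & cone_span R s u;
  cones_smooth : forall s, s \in cones X ->
    exists2 e : 'I_d -> 'rV[int]_d, Z_basis e &
      forall rho, rho \in s -> exists i, e i = gen rho;
  cones_ample : exists a : {ffun ray X -> int},
    forall b, curve_class b -> 0 < \sum_rho a rho * b rho }.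

(* Torus-invariant divisors \sum_rho a_rho D_rho with coefficients in K, and those
   of the form div(m) = \sum_rho <m, v_rho> D_rho. *)
Definition tdiv (K : comNzRingType) := {ffun ray X -> K^o}.

Definition principal (K : comNzRingType) : {pred tdiv K} :=
  fun D : tdiv K =>
    `[< exists m : 'cV[K]_d, forall rho, D rho = (genK K rho *m m) 0 0 >].
#[local] Arguments principal K D : clear implicits.

Lemma principalP (K : comNzRingType) (D : tdiv K) :
  reflect (exists m : 'cV[K]_d, forall rho, D rho = (genK K rho *m m) 0 0)
          (D \in principal K).
Proof. exact: asboolP. Qed.

Fact principal_zmod_closed (K : comNzRingType) : zmod_closed (principal K).
Proof.
split; first by apply/principalP; exists 0 => rho; rewrite mulmx0 mxE ffunE.
move=> D E /principalP[m Dm] /principalP[p Ep]; apply/principalP.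
by exists (m - p) => rho; rewrite !ffunE Dm Ep mulmxBr !mxE.
Qed.

HB.instance Definition _ (K : comNzRingType) :=
  GRing.isZmodClosed.Build (tdiv K) (principal K) (principal_zmod_closed K).

(* Pic(X) (x) K, presented as K^rays / M_K. *)
Definition PicK (K : comNzRingType) : Type := @Quotient.quot (tdiv K) (principal K).

HB.instance Definition _ (K : comNzRingType) := GRing.Zmodule.on (PicK K).
HB.instance Definition _ (K : comNzRingType) := EqQuotient.on (PicK K).

Definition cls (K : comNzRingType) (D : tdiv K) : PicK K := (\pi_(PicK K) D)%qT.

Lemma cls_eq (K : comNzRingType) (D E : tdiv K) :
  cls D = cls E <-> D - E \in principal K.
Proof. by rewrite (Quotient.idealrBE (principal K)); split=> [/eqP|/eqP]. Qed.

Lemma clsB (K : comNzRingType) : zmod_morphism (@cls K).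
Proof.
move=> D E; rewrite /cls.
exact: (@raddfB _ _ (\pi_(@Quotient.quot (tdiv K) (principal K)))%qT).
Qed.

HB.instance Definition _ (K : comNzRingType) :=
  GRing.isZmodMorphism.Build (tdiv K) (PicK K) (@cls K) (@clsB K).

Lemma cls_repr (K : comNzRingType) (c : PicK K) : cls (repr c) = c.
Proof. exact: reprK. Qed.

Definition scalePic (K : comNzRingType) (a : K) (c : PicK K) : PicK K :=
  cls (a *: repr c).

Lemma scale_cls (K : comNzRingType) (a : K) (D : tdiv K) :
  scalePic a (cls D) = cls (a *: D).
Proof.
apply/cls_eq; rewrite -scalerBr.
have /cls_eq/principalP[m Dm] := cls_repr (cls D).
apply/principalP; exists (a *: m) => rho.
by rewrite -scalemxAr [RHS]mxE -Dm !ffunE.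
Qed.

Fact scalePicA (K : comNzRingType) (a b : K) (c : PicK K) :
  scalePic a (scalePic b c) = scalePic (a * b) c.
Proof. by rewrite -(cls_repr c) !scale_cls scalerA. Qed.
Fact scalePic1 (K : comNzRingType) : left_id 1 (@scalePic K).
Proof. by move=> c; rewrite -(cls_repr c) scale_cls scale1r. Qed.
Fact scalePicDr (K : comNzRingType) : right_distributive (@scalePic K) +%R.
Proof.
move=> a c e; rewrite -(cls_repr c) -(cls_repr e) -raddfD !scale_cls.
by rewrite scalerDr raddfD.
Qed.
Fact scalePicDl (K : comNzRingType) (c : PicK K) :
  {morph (@scalePic K)^~ c : a b / a + b}.
Proof. by move=> a b; rewrite -(cls_repr c) !scale_cls scalerDl raddfD. Qed.

HB.instance Definition _ (K : comNzRingType) :=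
  GRing.Zmodule_isLmodule.Build K (PicK K)
    (@scalePicA K) (@scalePic1 K) (@scalePicDr K) (@scalePicDl K).

Definition Pic := PicK int.
HB.instance Definition _ := GRing.Zmodule.on Pic.

(* The canonical map Pic(X) -> Pic(X) (x) K. *)
Definition baseK (K : comNzRingType) (c : Pic) : PicK K :=
  cls [ffun rho => (repr c rho)%:~R : K^o].

Lemma baseK_cls (K : comNzRingType) (D : tdiv int) :
  baseK K (cls D) = cls [ffun rho => (D rho)%:~R : K^o].
Proof.
apply/cls_eq; have /cls_eq/principalP[m Dm] := cls_repr (cls D).
apply/principalP; exists (map_mx intr m) => rho.
have -> : genK K rho = map_mx intr (genK int rho).
  by apply/matrixP=> i j; rewrite !mxE intz.
rewrite -map_mxM mxE -Dm !ffunE /=.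
by rewrite intrB.
Qed.

(* Nef(X), as a cone in Pic(X) (x) R: the classes of divisors whose
   intersection number with every (torus-invariant) curve is nonnegative. *)
Definition Nef (R : realType) : set (PicK R) :=
  [set c | exists D : tdiv R, cls D = c /\
     forall b, curve_class b -> 0 <= \sum_rho D rho * (b rho)%:~R]%classic.
#[local] Arguments Nef R c : clear implicits.

Definition NefPic (R : realType) : set Pic := (baseK R @^-1` Nef R)%classic.

(* -K_X = \sum_rho D_rho *)
Definition antiK : Pic := cls [ffun _ => 1].

Definition tauZ (R : realType) (D : Pic) : \bar R :=
  ereal_sup [set s : \bar R | exists (r : nat) (a : 'I_r -> int) (E : 'I_r -> Pic),
    [/\ forall i, 0 < a i,
        forall i, E i != 0 /\ NefPic R (E i),
        D = \sum_i E i *~ a i &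
        s = (\sum_i (a i)%:~R)%:E]]%classic.

Definition tauQ (R : realType) (D : Pic) : \bar R :=
  ereal_sup [set s : \bar R | exists (r : nat) (a : 'I_r -> rat) (E : 'I_r -> Pic),
    [/\ forall i, 0 < a i,
        forall i, E i != 0 /\ NefPic R (E i),
        baseK rat D = \sum_i a i *: baseK rat (E i) &
        s = (\sum_i ratr (a i))%:E]]%classic.

Definition delta (R : realType) (D : Pic) : \bar R := (tauQ R D - tauZ R D)%E.

End FanTheory.

Record toric_manifold (R : realType) (d : nat) := ToricManifold {
  toric_fan :> fan d;
  toric_fanP : smooth_projective toric_fan R }.

Arguments genK {d X} K rho.
Arguments cone_span {d X} R s u.
Arguments curve_class {d X} b.
Arguments smooth_projective {d} X R.
Arguments principal {d} X K D.
Arguments cls {d X K} D.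
Arguments baseK {d X} K c.
Arguments Nef {d} X R c.
Arguments NefPic {d X} R c.
Arguments antiK {d} X.
Arguments tauZ {d X} R D.
Arguments tauQ {d X} R D.
Arguments delta {d X} R D.

Section Btilde.
Variables (d n : nat) (x : 'I_d.+1 -> 'rV[int]_d).

(* Indices are shifted by one: x_1, ..., x_(d+1) are x 0, ..., x d, the ray of
   x_(i+1) is [inl i], and the ray of y_(i+1) = - x_(i+1) is [inr i]. *)
Definition Btilde_ray : finType := Finite.clone ('I_d.+1 + 'I_n)%type _.

Definition Btilde_gen (rho : Btilde_ray) : 'rV[int]_d :=
  match rho with inl i => x i | inr i => - x (inord i) end.

Definition Btilde_primitive : {set {set Btilde_ray}} :=
  ([set [set inl (inord j); inr j] | j : 'I_n] :|:
   [set [set inl i | i : 'I_d.+1 & (n <= i)%N]])%SET.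

Definition Btilde_fan : fan d :=
  @Fan d Btilde_ray Btilde_gen
    [set s : {set Btilde_ray} | [forall P in Btilde_primitive, ~~ (P \subset s)]]%SET.

Hypothesis dn : (2 * n - 1 < d)%N.
Hypothesis x_basis : Z_basis (fun i : 'I_d => x (widen_ord (leqnSn d) i)).
Hypothesis x_sum : \sum_i x i = 0.

Let w (i : 'I_d) : 'I_d.+1 := widen_ord (leqnSn d) i.
Let yx (j : 'I_n) : 'I_d.+1 := inord j.

Let n_le_d : (n <= d)%N. Proof. lia. Qed.

Let yxE j : yx j = j :> nat.
Proof. by rewrite inordK // ltnS ltnW // (leq_trans (ltn_ord j)). Qed.

Let yx_inj : injective yx.
Proof. by move=> i j /(congr1 val) /=; rewrite !yxE => /val_inj. Qed.

Let yx_ex (i : 'I_d.+1) : (i < n)%N -> exists j, yx j = i.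
Proof. by move=> lti; exists (Ordinal lti); apply: ord_inj; rewrite yxE. Qed.

Let xK (K : pzRingType) i : 'rV[K]_d := map_mx intr (x i).

Let xK_sum (K : pzRingType) : \sum_i xK K i = 0.
Proof. by rewrite -map_mx_sum x_sum map_mx0. Qed.

Let inverse_ex : exists2 C : 'M[int]_d, C *m (\matrix_i x (w i)) = 1%:M &
   (\matrix_i x (w i)) *m C = 1%:M.
Proof.
have /boolp.choice[C hC] : forall k, exists c : {ffun 'I_d -> int},
    delta_mx 0 k = \sum_i x (w i) *~ c i.
  by move=> k; have [c [hc _]] := x_basis (delta_mx 0 k); exists c.
have CA : (\matrix_(k, i) C k i) *m (\matrix_i x (w i)) = 1%:M.
  apply/row_matrixP => k; rewrite rowE mulmxA -rowE row1 hC.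
  rewrite mulmx_sum_row; apply: eq_bigr => i _.
  by rewrite !rowK !mxE -scaler_int intz.
by exists (\matrix_(k, i) C k i) => //; exact: mulmx1C.
Qed.

Let sum_w (K : pzRingType) (c : 'I_d.+1 -> K) :
  \sum_i c i *: xK K i = \sum_(i < d) (c (w i) - c ord_max) *: xK K (w i).
Proof.
have := xK_sum K; rewrite !big_ord_recr /= => /(canRL (addKr _)) ->.
rewrite addr0 scalerN scaler_sumr -sumrB; apply: eq_bigr => i _.
by rewrite scalerBl.
Qed.

Let mxK (K : comNzRingType) (u : 'rV[K]_d) :
  u *m map_mx intr (\matrix_i x (w i)) = \sum_(i < d) u 0 i *: xK K (w i).
Proof.
rewrite mulmx_sum_row; apply: eq_bigr => i _; congr (_ *: _).
by apply/rowP=> k; rewrite !mxE.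
Qed.

Let x_gen (K : comNzRingType) (u : 'rV[K]_d) :
  exists c : 'I_d.+1 -> K, u = \sum_i c i *: xK K i.
Proof.
have [C CA _] := inverse_ex.
pose v := u *m map_mx intr C.
exists (fun i => if unlift ord_max i is Some k then v 0 k else 0).
rewrite sum_w unlift_none.
have -> : u = v *m map_mx intr (\matrix_i x (w i)).
  by rewrite -mulmxA -map_mxM CA map_mx1 mulmx1.
rewrite mxK; apply: eq_bigr => i _; rewrite subr0.
have -> : w i = lift ord_max i by apply: val_inj; rewrite /= /bump leqNgt ltn_ord.
by rewrite liftK.
Qed.

Let x_rel (K : comNzRingType) (c : 'I_d.+1 -> K) :
  \sum_i c i *: xK K i = 0 -> forall i j, c i = c j.
Proof.
have [C _ AC] := inverse_ex.
rewrite sum_w => h0.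
pose u : 'rV[K]_d := \row_i (c (w i) - c ord_max).
have hu : u *m map_mx intr (\matrix_i x (w i)) = 0.
  by rewrite mxK -[RHS]h0; apply: eq_bigr => i _; rewrite mxE.
have {hu} u0 : u = 0.
  have := congr1 (fun z => z *m map_mx intr C) hu.
  by rewrite -mulmxA -map_mxM AC map_mx1 mulmx1 mul0mx.
suff hi i : c i = c ord_max by move=> i j; rewrite !hi.
case: (unliftP ord_max i) => [k ->|-> //].
have -> : lift ord_max k = w k by apply: val_inj; rewrite /= /bump leqNgt ltn_ord.
by apply/eqP; rewrite -subr_eq0; move/rowP/(_ k): u0; rewrite !mxE => ->.
Qed.

Let net (K : pzRingType) (f : ray Btilde_fan -> K) (i : 'I_d.+1) : K :=
  f (inl i) - \sum_(j | yx j == i) f (inr j).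

Let net_lo (K : pzRingType) (f : ray Btilde_fan -> K) j :
  net f (yx j) = f (inl (yx j)) - f (inr j).
Proof. by rewrite /net (big_pred1 j) // => i; rewrite (inj_eq yx_inj). Qed.

Let net_hi (K : pzRingType) (f : ray Btilde_fan -> K) (i : 'I_d.+1) : (n <= i)%N -> net f i = f (inl i).
Proof.
move=> hi; rewrite /net big_pred0 ?subr0 // => j; apply/eqP => e.
by move: hi; rewrite -e yxE leqNgt ltn_ord.
Qed.

Let sum_net (K : comNzRingType) (f : ray Btilde_fan -> K) :
  \sum_rho f rho *: genK K rho = \sum_i net f i *: xK K i.
Proof.
rewrite big_sumType /=.
rewrite [X in _ + X](partition_big yx xpredT) //= -big_split /=.
apply: eq_bigr => i _; rewrite /net scalerBl; congr (_ + _).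
rewrite scaler_suml -sumrN; apply: eq_bigr => j /eqP <-.
by rewrite /genK /= map_mxN scalerN.
Qed.

Let conesP (s : {set ray Btilde_fan}) : reflect
  ((forall j, inr j \in s -> inl (yx j) \notin s) /\
   exists2 i : 'I_d.+1, (n <= i)%N & inl i \notin s) (s \in cones Btilde_fan).
Proof.
rewrite inE; apply: (iffP forall_inP) => [h|[h1 [i hi his]] P].
  split.
    move=> j js; have /h : [set inl (inord j); inr j]%SET \in Btilde_primitive.
      by apply/setUP; left; apply/imsetP; exists j.
    apply: contra => xs.
    by apply/fintype.subsetP => r; rewrite !inE => /orP[] /eqP ->.
  have /h : [set inl i | i : 'I_d.+1 & (n <= i)%N]%SET \in Btilde_primitive.
    by apply/setUP; right; rewrite inE.
  move=> /subsetPn[r /imsetP[i]].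
  by rewrite inE => hi -> his; exists i.
rewrite !inE => /orP[/imsetP[j _ ->]|/eqP ->]; apply/subsetPn.
  have [js|js] := boolP (inr j \in s).
    by exists (inl (inord j)); rewrite ?h1 // !inE eqxx.
  by exists (inr j) => //; rewrite !inE eqxx orbT.
by exists (inl i) => //; apply/imsetP; exists i; rewrite ?inE.
Qed.

Let Btilde_meet (R : realType) (s t : {set ray Btilde_fan}) :
  s \in cones Btilde_fan -> t \in cones Btilde_fan ->
  (cone_span R s `&` cone_span R t `<=` cone_span R (s :&: t))%classic.
Proof.
move=> /conesP[s1 [i0 hi0 i0s]] /conesP[t1 [k0 hk0 k0t]] u /=.
move=> [[f [f0 fs fu]] [g [g0 gt gu]]].
have netE i : net f i = net g i.
  have hc : forall i j, net f i - net g i = net f j - net g j.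
    apply: x_rel; apply/eqP; under eq_bigr do rewrite scalerBl.
    by rewrite sumrB -!sum_net -fu -gu subrr.
  have h1 := hc i0 k0; rewrite !net_hi // in h1.
  have h2 := hc i i0; rewrite (net_hi f hi0) (net_hi g hi0) in h2.
  have := g0 (inl i0); have := f0 (inl k0).
  have := fs _ i0s; have := gt _ k0t.
  lra.
have fg rho : f rho = g rho.
  have lo j : f (inl (yx j)) = g (inl (yx j)) /\ f (inr j) = g (inr j).
    have := netE (yx j); rewrite !net_lo.
    have := f0 (inl (yx j)); have := f0 (inr j).
    have := g0 (inl (yx j)); have := g0 (inr j).
    have [/s1/fs|/fs] := boolP (inr j \in s); have [/t1/gt|/gt] := boolP (inr j \in t);
      by split; lra.
  case: rho => [i|j]; last by case: (lo j).
  have [/yx_ex[j <-]|hi] := ltnP i n; first by case: (lo j).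
  by have := netE i; rewrite !net_hi.
exists f; split=> // rho; rewrite inE negb_and => /orP[/fs //|/gt].
by rewrite fg.
Qed.

Let Btilde_complete (R : realType) (u : 'rV[R]_d) :
  exists2 s, s \in cones Btilde_fan & cone_span R s u.
Proof.
have [c0 c0u] := x_gen u.
have nd : (n <= @ord_max d)%N by exact: n_le_d.
pose k := [arg min_(i < ord_max | (n <= i)%N) c0 i]%O.
have [hk kmin] : (n <= k)%N /\ forall i : 'I_d.+1, (n <= i)%N -> c0 k <= c0 i.
  by rewrite /k; case: arg_minP.
pose c i := c0 i - c0 k.
have cu : u = \sum_i c i *: xK R i.
  under eq_bigr do rewrite scalerBl.
  by rewrite sumrB -scaler_sumr xK_sum scaler0 subr0.
pose f (rho : ray Btilde_fan) : R := match rho with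
  | inl i => if (n <= i)%N then c i else Num.max (c i) 0
  | inr j => Num.max (- c (yx j)) 0 end.
pose s : {set ray Btilde_fan} := [set rho | f rho != 0]%SET.
have yxlt j : (n <= yx j)%N = false by rewrite yxE leqNgt ltn_ord.
exists s.
  apply/conesP; split.
    move=> j; rewrite !inE negbK /= yxlt.
    have [h|h] := leP (c (yx j)) 0; rewrite ?eqxx // max_r ?eqxx // oppr_le0.
    exact: ltW.
  by exists k; rewrite // inE negbK /= hk /c subrr.
exists f; split.
- case=> [i|j] /=; last by rewrite le_max lexx orbT.
  by case: ifP => hi; rewrite ?subr_ge0 ?kmin // le_max lexx orbT.
- by move=> rho; rewrite inE negbK => /eqP.
- rewrite sum_net cu; apply: eq_bigr => i _; congr (_ *: _).
  have [/yx_ex[j <-]|hi] := ltnP i n; last by rewrite net_hi //= hi.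
  rewrite net_lo /= yxlt.
  have [h|h] := leP (c (yx j)) 0; first by rewrite max_l ?oppr_ge0 // opprK add0r.
  by rewrite max_r ?subr0 // oppr_le0 ltW.
Qed.

Let xKZ i : xK int i = x i.
Proof. by apply/rowP=> k; rewrite mxE intz. Qed.

Let Btilde_smooth (s : {set ray Btilde_fan}) : s \in cones Btilde_fan ->
  exists2 e : 'I_d -> 'rV[int]_d, Z_basis e &
    forall rho, rho \in s -> exists i, e i = gen rho.
Proof.
move=> /conesP[s1 [k hk ks]].
pose sgn (i : 'I_d.+1) := [exists j, (yx j == i) && (inr j \in s)].
pose e (j : 'I_d) := let i := lift k j in if sgn i then - x i else x i.
pose ext (b : {ffun 'I_d -> int}) (i : 'I_d.+1) : int :=
  if unlift k i is Some j then (if sgn i then - b j else b j) else 0.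
have eE (b : {ffun 'I_d -> int}) : \sum_j e j *~ b j = \sum_i ext b i *: xK int i.
  rewrite [RHS](bigD1_ord k) //= {1}/ext unlift_none scale0r add0r.
  apply: eq_bigr => j _; rewrite /ext liftK xKZ -scaler_int intz /e.
  by case: (sgn _); rewrite // scaleNr scalerN.
exists e.
  move=> v; have [c cv] := x_gen v.
  pose b : {ffun 'I_d -> int} := [ffun j => if sgn (lift k j) then - (c (lift k j) - c k)
                       else c (lift k j) - c k].
  have bE i : ext b i = c i - c k.
    rewrite /ext; case: unliftP => [j ->|->]; last by rewrite subrr.
    by rewrite ffunE; case: (sgn _); rewrite ?opprK.
  exists b; split.
    rewrite eE cv; under [RHS]eq_bigr do rewrite bE scalerBl.
    by rewrite sumrB -scaler_sumr xK_sum scaler0 subr0.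
  move=> b' vb'; have hc : forall i j, ext b' i - c i = ext b' j - c j.
    apply: x_rel; under eq_bigr do rewrite scalerBl.
    by rewrite sumrB -eE -vb' -cv subrr.
  apply/ffunP => j; have := hc (lift k j) k.
  rewrite {1 2}/ext liftK unlift_none ffunE.
  by case: (sgn _) => /= h; lra.
case=> [i|j] hs.
  have ik : i != k by apply: contraTneq hs => ->.
  case: (unliftP k i) (ik) hs => [j ->|->]; last by rewrite eqxx.
  move=> _ hs; exists j; rewrite /e /= ifN //.
  by apply/existsP => -[j' /andP[/eqP j'E /s1]]; rewrite j'E hs.
have jk : yx j != k by apply: contraTneq hk => <-; rewrite yxE -ltnNge.
case: (unliftP k (yx j)) => [j' jE|jE]; last by rewrite jE eqxx in jk.
exists j'; rewrite /e -jE /= ifT //.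
by apply/existsP; exists j; rewrite eqxx.
Qed.

Let Btilde_ample : exists a : {ffun ray Btilde_fan -> int},
  forall b, curve_class b -> 0 < \sum_rho a rho * b rho.
Proof.
exists [ffun => 1] => b [t [r1 [r2 [[r1t r2t r12] [c1 c2 _] [b1 b2 bs] b0]]]].
under eq_bigr do rewrite ffunE mul1r.
have /x_rel netb : \sum_i net b i *: xK int i = 0.
  rewrite -sum_net -[RHS]b0; apply: eq_bigr => rho _; rewrite -scaler_int.
  by rewrite intz; congr (_ *: _); apply/rowP=> k; rewrite mxE intz.
have [s1 [k1 hk1 k1s]] := conesP _ c1; have [s2 [k2 hk2 k2s]] := conesP _ c2.
pose T := b (inl k1).
have netT i : net b i = T by rewrite (netb i k1) net_hi.
have Tlo j : b (inl (yx j)) = T + b (inr j) by rewrite -(netT (yx j)) net_lo subrK.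
have Thi (i : 'I_d.+1) : (n <= i)%N -> b (inl i) = T.
  by move=> hi; rewrite -(net_hi b hi).
have -> : \sum_rho b rho = T *+ d.+1 + (\sum_j b (inr j)) *+ 2.
  rewrite big_sumType /= mulr2n addrA; congr (_ + _).
  rewrite -[in T *+ _](card_ord d.+1) -sumr_const.
  rewrite [X in _ + X](partition_big yx xpredT) //= -big_split /=.
  by apply: eq_bigr => i _; rewrite -(netT i) /net subrK.
have in_t rho : b rho != 0 -> rho != r1 -> rho != r2 -> rho \in t.
  move=> brho n1 n2; apply: contraNT brho => rt.
  by rewrite bs // !inE (negPf n1) (negPf n2).
have not_both j : inr j \in t -> inl (yx j) \in t -> False.
  move=> h1 h2; have /s1 : inr j \in r1 |: t by rewrite inE h1 orbT.
  by rewrite inE h2 orbT.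
have yxN j (k : 'I_d.+1) : (n <= k)%N -> inl (yx j) != inl k :> ray Btilde_fan.
  by move=> hk; apply/eqP => -[e]; move: hk; rewrite -e yxE leqNgt ltn_ord.
have [T0|T0] := eqVneq T 0.
  have bge j : 0 <= b (inr j).
    have [->//|bj] := eqVneq (b (inr j)) 0.
    have [->|n1] := eqVneq (inr j : ray Btilde_fan) r1; first by rewrite b1.
    have [->|n2] := eqVneq (inr j : ray Btilde_fan) r2; first by rewrite b2.
    have jt := in_t _ bj n1 n2.
    have := Tlo j; rewrite T0 add0r => bl; rewrite -bl.
    have [->|m1] := eqVneq (inl (yx j) : ray Btilde_fan) r1; first by rewrite b1.
    have [->|m2] := eqVneq (inl (yx j) : ray Btilde_fan) r2; first by rewrite b2.
    by case: (not_both j) => //; apply: in_t => //; rewrite bl.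
  have [j bj] : exists j, b (inr j) = 1.
    case: r1 b1 {r1t r12 c1 bs s1 k1s in_t not_both bge} => [i bi|j bj]; last by exists j.
    have [/yx_ex[j ji]|/Thi] := ltnP i n; last by rewrite bi T0.
    by exists j; rewrite -bi -ji Tlo T0 add0r.
  rewrite T0 mul0rn add0r pmulrn_lgt0 // (bigD1 j) //= bj.
  by rewrite ltr_wpDr // sumr_ge0.
have k1E : inl k1 = r2.
  apply/eqP; apply: contraNT T0 => n2; rewrite /T.
  by rewrite bs // finset.setUCA inE negb_or inE n2.
have k2E : inl k2 = r1.
  apply/eqP; apply: contraNT T0 => n1; rewrite -(Thi _ hk2).
  by rewrite bs // inE negb_or inE n1.
have T1 : T = 1 by rewrite /T k1E.
have bge j : -1 <= b (inr j).
  have [->//|bj] := eqVneq (b (inr j)) 0.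
  have jt : inr j \in t by apply: in_t; rewrite // -?k1E -?k2E.
  have := Tlo j; rewrite T1.
  have -> : b (inl (yx j)) = 0.
    apply/eqP; apply: contraT => bl; case: (not_both j jt).
    by apply: in_t; rewrite // -?k1E -?k2E yxN.
  by lia.
have : \sum_(j < n) (-1 : int) <= \sum_j b (inr j) by apply: ler_sum.
rewrite sumr_const card_ord T1; have := dn; lia.
Qed.

Lemma Btilde_smooth_projective (R : realType) : smooth_projective Btilde_fan R.
Proof.
split; [|  | exact: Btilde_meet | exact: Btilde_complete | exact: Btilde_smooth
       | exact: Btilde_ample].
  move=> s t; rewrite !inE => /forall_inP h ts; apply/forall_inP => P /h.
  by apply: contra => Pt; exact: fintype.subset_trans Pt ts.
move=> rho; apply/conesP; split.
  by move=> j; rewrite !inE => /eqP <-.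
have [h|h] := eqVneq rho (inl ord_max); last first.
  by exists ord_max; rewrite ?inE 1?eq_sym.
have nd : (n < d.+1)%N by rewrite ltnS.
exists (Ordinal nd) => //; rewrite inE h; apply/eqP => -[e].
by move: dn; rewrite e; lia.
Qed.

Definition Btilde (R : realType) : toric_manifold R d :=
  ToricManifold (Btilde_smooth_projective R).

End Btilde.

Arguments Btilde {d n x} dn x_basis x_sum R.

(* Main.v *)
Require Import Defs.
From HB Require Import structures.
From mathcomp Require Import all_boot all_order all_algebra.
From mathcomp Require Import boolp classical_sets reals constructive_ereal ereal.
From mathcomp Require Import zify ring.

(** An integral relation b between the ray generators of X is a 1-cycle, and
    pairing it with divisors gives a degree Pic(X) (x) K -> K.  Suppose that
    finitely many curve classes C_k and nef classes e_k satisfy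
    e_l . C_k = delta_kl, and that a class of degree 0 along all the C_k
    vanishes (structure dual_nef_basis).  Then the degrees are coordinates on
    Pic(X) (x) K, with basis the e_k, and every class is c = sum_k (c . C_k) e_k.
    Since the e_k are nef and the C_k are curves, c is nef iff all c . C_k >= 0
    (NefE): the nef cone is the positive orthant on a Z-basis of Pic(X), so it
    is unimodular (unimodular_Nef).

    On such an X a nonzero nef integral class has total degree sum_k c . C_k at
    least 1, hence a decomposition D = sum_i a_i D_i into nonzero nef classes,
    even with rational a_i, satisfies sum_i a_i <= sum_k D . C_k
    (nef_length_le).  The integral decomposition along the e_k attains this
    bound (nef_decomposition), so that tau_X(D; Z) and tau_X(D; Q) both equal
    the total degree of D (tau_nef).

    For the model of the theorem (Btilde_dual_nef_basis), with the rays numbered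
    from 1 as x_1, ..., x_(d+1) and y_1, ..., y_n, the curve classes are
    the relations x_j + y_j = 0, and
    x_(n+1) + ... + x_(d+1) - y_1 - ... - y_n = 0; dually e_j is the class of
    the divisor of x_j, and the last nef class is that of the divisor of
    x_(d+1).  Nefness of these divisors comes from primitive collections: the
    rays on which a curve class is negative, together with any one ray on which
    it is nonzero, lie in a common cone (curve_class_cone), whereas
    x_(n+1), ..., x_(d+1), or x_j and y_j, do not.  Finally -K has degree 2 on
    the first n curves and d + 1 - 2n > 0 on the last one, in total d + 1. *)

Set Implicit Arguments.
Unset Strict Implicit.
Unset Printing Implicit Defensive.

Import Order.TTheory GRing.Theory Num.Theory.

Local Open Scope ring_scope.

(** * Degrees of divisor classes along 1-cycles *)

Section Degree.
Variables (d : nat) (X : fan d).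

(** N_1(X) as the lattice of integral relations between the ray generators:
    b rho is the intersection number of the cycle with the divisor of rho. *)
Record one_cycle := OneCycle {
  coef :> {ffun ray X -> int};
  coef_rel : \sum_rho gen rho *~ coef rho = 0 }.

Implicit Types b : one_cycle.

Definition inter (K : comNzRingType) (b : {ffun ray X -> int}) (D : tdiv X K) : K^o :=
  \sum_rho D rho * (b rho)%:~R.

Fact inter_is_linear (K : comNzRingType) (b : {ffun ray X -> int}) :
  linear (@inter K b).
Proof.
move=> a D E; rewrite /inter scaler_sumr -big_split /=.
by apply: eq_bigr => rho _; rewrite !ffunE mulrDl scalerAl.
Qed.

HB.instance Definition _ (K : comNzRingType) (b : {ffun ray X -> int}) :=
  GRing.isLinear.Build K (tdiv X K) K^o _ (@inter K b) (@inter_is_linear K b).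

(** The pairing of div(m) with b is the value of the linear form m on the
    relation b, hence 0. *)
Lemma inter_principal (K : comNzRingType) b (D : tdiv X K) :
  D \in principal X K -> inter b D = 0.
Proof.
move=> /principalP[m Dm].
transitivity ((map_mx intr (\sum_rho gen rho *~ b rho) *m m) 0 0 : K); last first.
  by rewrite coef_rel map_mx0 mul0mx mxE.
rewrite map_mx_sum mulmx_suml summxE; apply: eq_bigr => rho _.
by rewrite Dm raddfMz /= -[X in _ = (X *m m) _ _]scaler_int -scalemxAl [RHS]mxE mulrC.
Qed.

Definition deg (K : comNzRingType) b (c : PicK X K) : K^o := inter b (repr c).

Lemma deg_cls (K : comNzRingType) b (D : tdiv X K) : deg b (cls D) = inter b D.
Proof.
have /cls_eq/(inter_principal b)/eqP := cls_repr (cls D).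
by rewrite raddfB subr_eq0 => /eqP.
Qed.

Fact deg_is_linear (K : comNzRingType) b : linear (@deg K b).
Proof.
move=> a c c'; rewrite -(cls_repr c) -(cls_repr c').
by rewrite [a *: _]scale_cls -raddfD !deg_cls linearP.
Qed.

HB.instance Definition _ (K : comNzRingType) b :=
  GRing.isLinear.Build K (PicK X K) K^o _ (@deg K b) (@deg_is_linear K b).

Lemma deg_baseK (K : comNzRingType) b (c : Pic X) :
  deg b (baseK K c) = (deg b c)%:~R.
Proof.
rewrite -(cls_repr c) baseK_cls !deg_cls rmorph_sum /=.
by apply: eq_bigr => rho _; rewrite ffunE intz rmorphM.
Qed.

Lemma deg_Zcomb b r (a : 'I_r -> int) (F : 'I_r -> Pic X) :
  deg b (\sum_i F i *~ a i) = \sum_i deg b (F i) * a i.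
Proof.
rewrite (raddf_sum (deg b)) /=; apply: eq_bigr => i _.
by rewrite raddfMz /= -mulrzr intz.
Qed.

Lemma baseK_int (c : Pic X) : baseK int c = c.
Proof.
rewrite -(cls_repr c) baseK_cls; congr cls.
by apply/ffunP => rho; rewrite ffunE intz.
Qed.

Lemma curve_class_rel (b : {ffun ray X -> int}) :
  curve_class b -> \sum_rho gen rho *~ b rho = 0.
Proof. by case=> t [r1 [r2 []]]. Qed.

(** The class of a wall curve is positive on the two rays off the wall and
    vanishes outside the two adjacent maximal cones, so its negative rays are in
    the wall and each ray of its support is in one of these cones.  This is what
    excludes curve classes that are negative on too much of a primitive
    collection. *)
Lemma curve_class_cone (b : {ffun ray X -> int}) sigma : curve_class b -> b sigma != 0 ->
  exists2 s, s \in cones X & forall rho, b rho < 0 \/ rho = sigma -> rho \in s.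
Proof.
case=> t [r1 [r2 [[_ _ _] [s1 s2 _] [b1 b2 b0] _]]] bs.
have in_t rho : b rho < 0 -> rho \in t.
  move=> blt; have : rho \in r1 |: (r2 |: t).
    by apply: contraTT blt => /b0 ->; rewrite ltxx.
  by rewrite !inE => /or3P[/eqP E|/eqP E|//]; move: blt; rewrite E ?b1 ?b2.
have : sigma \in r1 |: (r2 |: t) by apply: contraNT bs => /b0 ->.
rewrite finset.setUCA => /setU1P[->|h].
  by exists (r2 |: t) => // rho [/in_t h|->]; rewrite !inE ?h ?orbT ?eqxx.
by exists (r1 |: t) => // rho [/in_t h'|-> //]; rewrite !inE ?h' ?orbT.
Qed.

Lemma Nef_deg (R : realType) (c : PicK X R) :
  Nef X R c <-> forall b, curve_class b -> 0 <= deg b c.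
Proof.
split=> [[D [<- Dnef]] b bC|cge0]; first by rewrite deg_cls; exact: Dnef.
exists (repr c); split=> [|b bC]; first exact: cls_repr.
exact: (cge0 (OneCycle (curve_class_rel bC))).
Qed.

End Degree.

(** * Nef cones with a dual basis of curves *)

(** The last field, for all coefficient rings at once, says that the C_k
    detect linear equivalence; with the delta relations it makes the e_k a basis
    of Pic(X) (x) K that is compatible with change of coefficients. *)
Record dual_nef_basis (d : nat) (X : fan d) (I : finType)
    (C : I -> one_cycle X) (e : I -> Pic X) : Prop := DualNefBasis {
  dual_curve : forall k, curve_class (C k);
  dual_nef : forall k b, curve_class (coef b) -> 0 <= deg b (e k);
  dual_delta : forall k l, deg (C k) (e l) = (k == l)%:R;
  dual_separates : forall (K : comNzRingType) (c : PicK X K),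
    (forall k, deg (C k) c = 0) -> c = 0 }.

Section DualNefBasis.
Variables (d : nat) (X : fan d) (I : finType) (C : I -> one_cycle X) (e : I -> Pic X).
Hypothesis Ce : dual_nef_basis C e.

Lemma deg_basis (K : comNzRingType) k l : deg (C k) (baseK K (e l)) = (k == l)%:R.
Proof. by rewrite deg_baseK (dual_delta Ce); case: eqP. Qed.

Lemma deg_inj (K : comNzRingType) (c c' : PicK X K) :
  (forall k, deg (C k) c = deg (C k) c') -> c = c'.
Proof.
move=> cc'; apply/eqP; rewrite -subr_eq0; apply/eqP/(dual_separates Ce) => k.
by rewrite raddfB /= cc' subrr.
Qed.

Lemma deg_comb (K : comNzRingType) (a : I -> K) k :
  deg (C k) (\sum_l a l *: baseK K (e l)) = a k.
Proof.
rewrite linear_sum /= (bigD1 k) //= big1 => [|l lk].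
  by rewrite addr0 linearZ /= deg_basis eqxx [_ *: _]mulr1.
by rewrite linearZ /= deg_basis eq_sym (negPf lk) [_ *: _]mulr0.
Qed.

Lemma deg_expand (K : comNzRingType) (c : PicK X K) :
  c = \sum_k (deg (C k) c : K) *: baseK K (e k).
Proof. by apply: deg_inj => k; rewrite deg_comb. Qed.

Lemma Pic_int_comb (a : I -> int) : \sum_k e k *~ a k = \sum_k a k *: baseK int (e k).
Proof. by apply: eq_bigr => k _; rewrite baseK_int -scaler_int intz. Qed.

Lemma Pic_basis : Z_basis e.
Proof.
move=> c; exists [ffun k => deg (C k) c]; split.
  by rewrite Pic_int_comb {1}[c](@deg_expand int); apply: eq_bigr => k _; rewrite ffunE.
move=> a ->; apply/ffunP => k; rewrite ffunE Pic_int_comb.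
exact: (@deg_comb int).
Qed.

Variable R : realType.

(** Nef classes have degree at least 0 on the curves C_k; conversely, the
    expansion of c on the nef classes e_k has the degrees along C_k as its
    coefficients. *)
Lemma NefE (c : PicK X R) : Nef X R c <-> forall k, 0 <= deg (C k) c.
Proof.
rewrite Nef_deg; split=> [h k|cge0 b bC]; first exact/h/(dual_curve Ce).
rewrite [c]deg_expand linear_sum /=; apply: sumr_ge0 => k _.
by rewrite linearZ /= deg_baseK mulr_ge0 // ler0z (dual_nef Ce).
Qed.

Lemma NefPicE (c : Pic X) : NefPic R c <-> forall k, 0 <= deg (C k) c.
Proof.
rewrite /NefPic /=; split=> [/NefE h k|h]; first by have := h k; rewrite deg_baseK ler0z.
by apply/NefE => k; rewrite deg_baseK ler0z.
Qed.

Lemma Nef_basis k : Nef X R (baseK R (e k)).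
Proof. by apply/NefE => l; rewrite deg_basis; case: eqP. Qed.

Lemma Nef_generated : Nef X R =
  [set v | exists2 t : I -> R, forall i, 0 <= t i & v = \sum_i t i *: baseK R (e i)]%classic.
Proof.
apply/seteqP; split=> [c /NefE c0|c [t t0 ->]] /=.
  by exists (fun k => deg (C k) c) => //; exact: deg_expand.
by apply/NefE => k; rewrite deg_comb.
Qed.

Lemma Nef_strongly_convex : strongly_convex (Nef X R).
Proof.
move=> c /NefE c0 /NefE cN0; apply: (dual_separates Ce) => k.
by apply/eqP; rewrite eq_le c0 andbT -oppr_ge0 -raddfN cN0.
Qed.

Lemma primitive_basis k : primitive_vector (e k).
Proof.
move=> w m /(congr1 (deg (C k))).
rewrite (dual_delta Ce) eqxx raddfMn /= -[X in _ = X]mulr_natr.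
by move=> /(congr1 absz)/esym/eqP; rewrite abszM muln_eq1 => /andP[_ /eqP]; rewrite natz.
Qed.

Lemma extremal_ray_basis k : extremal_ray (Nef X R) (baseK R (e k)).
Proof.
split; first exact: Nef_basis.
  apply/eqP => /(congr1 (deg (C k))); rewrite raddf0 deg_basis eqxx.
  exact/eqP/oner_neq0.
move=> u w /NefE u0 /NefE w0 uw; exists (deg (C k) u) => //.
apply: deg_inj => l; rewrite linearZ /= deg_basis.
have [->|lk] := eqVneq l k; first by rewrite [_ *: _]mulr1.
apply/eqP; rewrite [_ *: _]mulr0 eq_le u0 andbT.
have := congr1 (deg (C l)) uw; rewrite raddfD /= deg_basis (negPf lk) mulr0n => <-.
by rewrite lerDl.
Qed.

(** Splitting off the component along e_k writes c as a sum of two nef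
    classes; extremality makes this component proportional to c, with factor 1
    when it is nonzero. *)
Lemma extremal_multiple c : extremal_ray (Nef X R) (baseK R c) ->
  exists2 k, 0 < deg (C k) c & c = e k *~ deg (C k) c.
Proof.
case=> /NefPicE c0 cn0 ext.
have [k ck] : exists k, 0 < deg (C k) c.
  apply: contrapT => /forallNP h; case/eqP: cn0.
  apply: (dual_separates Ce) => k; rewrite deg_baseK.
  suff -> : deg (C k) c = 0 by [].
  by apply/eqP; rewrite eq_le c0 andbT leNgt; apply/negP.
exists k => //.
pose u : PicK X R := (deg (C k) c)%:~R *: baseK R (e k).
pose w : PicK X R := \sum_(l | l != k) (deg (C l) c)%:~R *: baseK R (e l).
have uNef : Nef X R u.
  by apply/NefE => l; rewrite linearZ /= deg_basis mulr_ge0 ?ler0n ?ler0z.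
have wNef : Nef X R w.
  apply/NefE => l; rewrite linear_sum /=; apply: sumr_ge0 => l' _.
  by rewrite linearZ /= deg_basis mulr_ge0 ?ler0n ?ler0z.
have uw : u + w = baseK R c.
  rewrite [RHS]deg_expand [RHS](bigD1 k) //= deg_baseK; congr (_ + _).
  by apply: eq_bigr => l _; rewrite deg_baseK.
have [t _ tE] := ext u w uNef wNef uw.
have tl l := congr1 (deg (C l)) tE.
have ck0 : (deg (C k) c)%:~R != 0 :> R by rewrite intr_eq0 gt_eqF.
have t1 : t = 1.
  have := tl k; rewrite !linearZ /= deg_basis deg_baseK eqxx [_ *: 1]mulr1.
  by rewrite -[LHS]mul1r => /(mulIf ck0).
apply: (@deg_inj int) => l; rewrite raddfMz /= (dual_delta Ce).
have := tl l; rewrite t1 scale1r linearZ /= deg_basis deg_baseK.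
have [->|lk] := eqVneq l k; first by rewrite intz.
by rewrite mul0rz [_ *: _]mulr0 => /esym/eqP; rewrite intr_eq0 => /eqP.
Qed.

Lemma unimodular_Nef : unimodular (baseK R : Pic X -> PicK X R) (Nef X R).
Proof.
have sum_enum (F : I -> PicK X R) : \sum_k F k = \sum_(i < #|I|) F (enum_val i).
  by rewrite (reindex _ (onW_bij _ (enum_val_bij I))).
split; last exists #|I|, (e \o enum_val); first 1 last.
- exists #|I|, (baseK R \o e \o enum_val), (fun i => deg (C (enum_val i)) v).
  split=> [i|] /=; first exact: Nef_basis.
  by rewrite -(sum_enum (fun k => deg (C k) v *: baseK R (e k))); exact: deg_expand.
- exact: Nef_strongly_convex.
- split.
  + move=> i j /= eij; apply: enum_val_inj; apply/eqP.
    have := congr1 (deg (C (enum_val i))) eij.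
    by rewrite !(dual_delta Ce) eqxx; case: eqP.
  + move=> v; split=> [[/extremal_multiple[k vk vE] prim]|[i <-]]; last first.
      by split; [exact: extremal_ray_basis|exact: primitive_basis].
    exists (enum_rank k); rewrite /= enum_rankK [RHS]vE.
    have := prim (e k) `|deg (C k) v|%N.
    by rewrite {1}vE pmulrn gtz0_abs // => /(_ erefl) v1; rewrite -[deg _ v]gtz0_abs // v1.
  + move=> v; have [c [vE cuniq]] := Pic_basis v.
    exists [ffun i => c (enum_val i)]; split.
      rewrite vE (reindex _ (onW_bij _ (enum_val_bij I))) /=.
      by apply: eq_bigr => i _; rewrite ffunE.
    move=> b vb; apply/ffunP => i; rewrite ffunE.
    rewrite (cuniq [ffun k => b (enum_rank k)]) ?ffunE ?enum_valK //.
    rewrite vb (reindex _ (onW_bij _ (enum_val_bij I))) /=.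
    by apply: eq_bigr => j _; rewrite ffunE enum_valK.
- exists #|I|, (e \o enum_val); rewrite Nef_generated.
  apply/seteqP; split=> c /= [t t0 ->].
    by exists (t \o enum_val) => [i|] /=; [exact: t0|rewrite sum_enum].
  exists (t \o enum_rank) => [k|] /=; first exact: t0.
  by rewrite sum_enum; apply: eq_bigr => i _; rewrite enum_valK.
Qed.

Definition total_deg (K : comNzRingType) (c : PicK X K) : K := \sum_k deg (C k) c.

(** The degrees are nonnegative integers, not all zero. *)
Lemma total_deg_ge1 (c : Pic X) : c != 0 -> NefPic R c -> 1 <= total_deg c.
Proof.
move=> cn0 /NefPicE c0; rewrite -gtz0_ge1 lt_def sumr_ge0 // andbT.
apply: contra cn0 => /eqP /psumr_eq0P h; apply/eqP/(dual_separates Ce) => k.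
exact: h.
Qed.

(** Total degree is linear over the rationals, and total_deg_ge1 bounds it
    below on each F i. *)
Lemma nef_length_le r (a : 'I_r -> rat) (F : 'I_r -> Pic X) (D : Pic X) :
  (forall i, 0 < a i) -> (forall i, F i != 0 /\ NefPic R (F i)) ->
  baseK rat D = \sum_i a i *: baseK rat (F i) ->
  \sum_i a i <= (total_deg D)%:~R.
Proof.
move=> a0 F0 DE.
have -> : (total_deg D)%:~R = \sum_i a i * (total_deg (F i))%:~R.
  rewrite /total_deg rmorph_sum /=; under eq_bigr => k _ do
    rewrite -deg_baseK DE linear_sum /=.
  rewrite exchange_big; apply: eq_bigr => i _ /=.
  rewrite rmorph_sum mulr_sumr /=; apply: eq_bigr => k _.
  by rewrite linearZ /= deg_baseK.
apply: ler_sum => i _; have [Fn0 FN] := F0 i.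
by rewrite ler_peMr ?(ltW (a0 i)) // ler1z total_deg_ge1.
Qed.

(** Only the e_k along which D has positive degree may occur, since the
    coefficients of a decomposition are required to be positive. *)
Lemma nef_decomposition (D : Pic X) : NefPic R D ->
  exists (r : nat) (a : 'I_r -> int) (F : 'I_r -> Pic X),
    [/\ forall i, 0 < a i, forall i, F i != 0 /\ NefPic R (F i),
        D = \sum_i F i *~ a i & \sum_i a i = total_deg D].
Proof.
move=> /NefPicE D0; pose A := [set k | deg (C k) D != 0]%SET.
exists #|A|, (fun i => deg (C (enum_val i)) D), (fun i => e (enum_val i)); split.
- move=> i; have := enum_valP i; rewrite inE => Di.
  by rewrite lt_def Di D0.
- move=> i; split; last exact: Nef_basis.
  apply/eqP => /(congr1 (deg (C (enum_val i)))).
  by rewrite (dual_delta Ce) eqxx raddf0.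
- rewrite -(big_enum_val (fun k => e k *~ deg (C k) D)).
  rewrite {1}[D](@deg_expand int) -Pic_int_comb [RHS]big_mkcond /=.
  by apply: eq_bigr => k _; rewrite inE; case: eqP => [->|].
- rewrite -(big_enum_val (fun k => deg (C k) D)) big_mkcond /=.
  by apply: eq_bigr => k _; rewrite inE; case: eqP.
Qed.

Lemma tau_nef (D : Pic X) : NefPic R D ->
  tauZ R D = (total_deg D)%:~R%:E /\ tauQ R D = (total_deg D)%:~R%:E.
Proof.
move=> DN; have [r [a [F [a0 F0 DE aE]]]] := nef_decomposition DN.
have Zle : ((total_deg D)%:~R%:E <= tauZ R D)%E.
  apply: ereal_sup_ubound; exists r, a, F; split=> //.
  by rewrite -aE rmorph_sum.
have Qle : (tauQ R D <= (total_deg D)%:~R%:E)%E.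
  apply: ge_ereal_sup => _ [r' [b [G [b0 G0 DG ->]]]].
  rewrite lee_fin -rmorph_sum /= -ratr_int ler_rat.
  exact: nef_length_le DG.
have ZQ : (tauZ R D <= tauQ R D)%E.
  apply: le_ereal_sup => _ [r' [b [G [b0 G0 DG ->]]]].
  exists r', (fun i => (b i)%:~R), G; split=> //.
  - by move=> i; rewrite ltr0z.
  - apply: deg_inj => k; rewrite deg_baseK {1}DG deg_Zcomb linear_sum rmorph_sum /=.
    by apply: eq_bigr => i _; rewrite linearZ /= deg_baseK rmorphM mulrC.
  - by congr EFin; apply: eq_bigr => i _; rewrite ratr_int.
by split; apply/eqP; rewrite eq_le; apply/andP; split=> //;
  do ?[exact: le_trans Zle ZQ | exact: le_trans ZQ Qle].
Qed.

End DualNefBasis.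

(** * The model *)

Section BtildeNef.
Variables (d n : nat) (x : 'I_d.+1 -> 'rV[int]_d).
Hypothesis dn : (2 * n - 1 < d)%N.
Hypothesis x_basis : Z_basis (fun i : 'I_d => x (widen_ord (leqnSn d) i)).
Hypothesis x_sum : \sum_i x i = 0.

Local Notation B := (Btilde_fan n x).
Let X (i : 'I_d.+1) : ray B := inl i.
Let Y (j : 'I_n) : ray B := inr j.
Let lo (j : 'I_n) : 'I_d.+1 := inord j.

Let eqXX i k : (X i == X k) = (i == k). Proof. by []. Qed.
Let eqYY j l : (Y j == Y l) = (j == l). Proof. by []. Qed.
Let eqXY i j : (X i == Y j) = false. Proof. by []. Qed.
Let eqYX i j : (Y j == X i) = false. Proof. by []. Qed.

Let n_lt_d : (n < d)%N. Proof. lia. Qed.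

Let loE j : lo j = j :> nat.
Proof. by rewrite inordK // ltnS ltnW // (ltn_trans (ltn_ord j)). Qed.

Let lo_inj : injective lo.
Proof. by move=> i j /(congr1 val) /=; rewrite !loE => /val_inj. Qed.

Let lo_lt j : (n <= lo j)%N = false.
Proof. by rewrite loE leqNgt ltn_ord. Qed.

Let lo_max j : (lo j == ord_max) = false.
Proof. by apply/eqP => /(congr1 val); rewrite /= loE; have := ltn_ord j; lia. Qed.

Lemma sum_low_high (V : zmodType) (F : 'I_d.+1 -> V) :
  \sum_i F i = \sum_j F (lo j) + \sum_(i : 'I_d.+1 | (n <= i)%N) F i.
Proof.
rewrite (bigID (fun i : 'I_d.+1 => (i < n)%N)) /=; congr (_ + _).
  rewrite (big_ord_widen d.+1 (fun k => F (inord k))); last by rewrite ltnW // ltnW.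
  by apply: eq_bigr => i _; rewrite inord_val.
by apply: eq_bigl => i; rewrite -leqNgt.
Qed.

Lemma Btilde_cone_intro (s : {set ray B}) (i : 'I_d.+1) :
  (forall j, Y j \in s -> X (lo j) \notin s) -> (n <= i)%N -> X i \notin s -> s \in cones B.
Proof.
move=> sXY ni si; rewrite inE; apply/forall_inP => P.
rewrite !inE => /orP[/imsetP[j _ ->]|/eqP ->]; apply/subsetPn.
  have [js|js] := boolP (Y j \in s).
    by exists (X (lo j)); rewrite ?sXY // !inE eqxx.
  by exists (Y j) => //; rewrite !inE eqxx orbT.
by exists (X i) => //; apply/imsetP; exists i; rewrite // inE.
Qed.

Lemma Btilde_cone_pair (s : {set ray B}) j :
  s \in cones B -> X (lo j) \in s -> Y j \in s -> False.
Proof.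
rewrite inE => /forall_inP h Xs Ys.
have /h/negP : [set inl (inord j); inr j]%SET \in Btilde_primitive d n.
  by apply/setUP; left; apply/imsetP; exists j.
by apply; apply/fintype.subsetP => r; rewrite !inE => /orP[] /eqP ->.
Qed.

Lemma Btilde_cone_high (s : {set ray B}) :
  s \in cones B -> (forall i : 'I_d.+1, (n <= i)%N -> X i \in s) -> False.
Proof.
rewrite inE => /forall_inP h Xs.
have /h/negP : [set inl i | i : 'I_d.+1 & (n <= i)%N]%SET \in Btilde_primitive d n.
  by apply/setUP; right; rewrite inE.
by apply; apply/fintype.subsetP => r /imsetP[i]; rewrite inE => ni ->; apply: Xs.
Qed.

(** A linear form m with prescribed values D on the basis x_1, ..., x_d takes
    the value D at x_(d+1) and at the y_j as well, by the relations that the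
    hypotheses on D reflect. *)
Lemma principal_Btilde (K : comNzRingType) (D : tdiv B K) :
  (forall j, D (X (lo j)) + D (Y j) = 0) -> \sum_i D (X i) = 0 -> D \in principal B K.
Proof.
move=> DXY DX; pose w (i : 'I_d) := widen_ord (leqnSn d) i.
have /boolp.choice[c hc] : forall k, exists c : {ffun 'I_d -> int},
    delta_mx 0 k = \sum_i x (w i) *~ c i.
  by move=> k; have [c [hc _]] := x_basis (delta_mx 0 k); exists c.
pose A := \matrix_i x (w i).
(* the rows of c are the coordinates of the standard basis in the basis x *)
have AC : A *m (\matrix_(k, i) c k i) = 1%:M.
  apply: mulmx1C; apply/row_matrixP => k; rewrite rowE mulmxA -rowE row1 hc.
  rewrite mulmx_sum_row; apply: eq_bigr => i _.
  by rewrite !rowK !mxE -scaler_int intz.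
pose m : 'cV[K]_d := map_mx intr (\matrix_(k, i) c k i) *m \col_i D (X (w i)).
have Dw i : (map_mx intr (x (w i)) *m m) 0 0 = D (X (w i)).
  have -> : map_mx intr (x (w i)) = row i (map_mx intr A) :> 'rV[K]_d.
    by apply/rowP=> k; rewrite !mxE.
  by rewrite -row_mul mulmxA -map_mxM AC map_mx1 mul1mx !mxE.
have DXE i : (map_mx intr (x i) *m m) 0 0 = D (X i).
  have [k ->|->] := unliftP ord_max i.
    by have <- : w k = lift ord_max k by apply: val_inj; rewrite /= /bump leqNgt ltn_ord.
  have := congr1 (fun u : 'rV_d => (map_mx intr u *m m) 0 0) x_sum.
  rewrite map_mx_sum mulmx_suml summxE map_mx0 mul0mx mxE.
  rewrite -{2}DX !big_ord_recr /=.
  by under eq_bigr do rewrite Dw; move/addrI.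
apply/principalP; exists m => -[i|j]; first by rewrite -DXE.
rewrite /genK /= map_mxN mulNmx mxE DXE.
by apply/eqP; rewrite -addr_eq0 addrC DXY.
Qed.

(** The relation x_j + y_j = 0, the class of the fibers of a P^1-bundle. *)
Definition fiber_coef (j : 'I_n) : {ffun ray B -> int} :=
  [ffun rho => ((rho == X (lo j)) || (rho == Y j))%:R].

(** The primitive relation x_(n+1) + ... + x_(d+1) - y_1 - ... - y_n = 0. *)
Definition high_coef : {ffun ray B -> int} :=
  finfun (fun rho : Btilde_ray d n => match rho return int with
    inl i => (n <= i)%N%:R | inr _ => -1 end).

Lemma sum_fiber (V : zmodType) (F : ray B -> V) j :
  \sum_rho F rho *~ fiber_coef j rho = F (X (lo j)) + F (Y j).
Proof.
rewrite (bigD1 (X (lo j))) //= (bigD1 (Y j)) //= big1 => [|rho /andP[/negPf r1 /negPf r2]].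
  by rewrite !ffunE !eqxx orbT addr0.
by rewrite ffunE r1 r2.
Qed.

Lemma sum_high (V : zmodType) (F : ray B -> V) :
  \sum_rho F rho *~ high_coef rho = \sum_(i : 'I_d.+1 | (n <= i)%N) F (X i) - \sum_j F (Y j).
Proof.
rewrite big_sumType /= -sumrN; congr (_ + _).
  by rewrite [RHS]big_mkcond /=; apply: eq_bigr => i _; rewrite ffunE; case: leqP.
by apply: eq_bigr => j _; rewrite ffunE mulrN1z.
Qed.

Lemma fiber_rel j : \sum_rho gen rho *~ fiber_coef j rho = 0.
Proof. by rewrite sum_fiber /= subrr. Qed.

Lemma high_rel : \sum_rho gen rho *~ high_coef rho = 0.
Proof. by rewrite sum_high /= sumrN opprK addrC -sum_low_high. Qed.

Definition Btilde_cycle (k : option 'I_n) : one_cycle B :=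
  if k is Some j then OneCycle (fiber_rel j) else OneCycle high_rel.

Definition ray_class (rho : ray B) : Pic B := cls [ffun s => (s == rho)%:R].

Definition Btilde_nef (k : option 'I_n) : Pic B :=
  ray_class (X (if k is Some j then lo j else ord_max)).

Lemma inter_ray (b : {ffun ray B -> int}) rho :
  inter b ([ffun s => (s == rho)%:R] : tdiv B int) = b rho.
Proof.
rewrite /inter (bigD1 rho) //= big1 => [|s /negPf sr].
  by rewrite addr0 ffunE eqxx mul1r intz.
by rewrite ffunE sr mul0r.
Qed.

Lemma deg_ray (b : one_cycle B) rho : deg b (ray_class rho) = b rho.
Proof. by rewrite deg_cls inter_ray. Qed.

Let ind (k : 'I_d.+1) : \sum_i ((i == k)%:R : int) = 1.
Proof. by rewrite (bigD1 k) //= eqxx big1 ?addr0 // => l /negPf ->. Qed.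

(** The divisors of x_(n+1), ..., x_(d+1) are linearly equivalent. *)
Lemma cycle_high (b : one_cycle B) (i : 'I_d.+1) : (n <= i)%N -> b (X i) = b (X ord_max).
Proof.
move=> ni; rewrite -!inter_ray; apply/eqP; rewrite -subr_eq0 -raddfB; apply/eqP.
apply: inter_principal; apply: principal_Btilde => [j|].
  rewrite !ffunE !eqXX lo_max.
  have -> : (lo j == i) = false by apply: contraTF ni => /eqP <-; rewrite lo_lt.
  by rewrite !eqYX.
under eq_bigr do rewrite !ffunE !eqXX.
by rewrite sumrB !ind subrr.
Qed.

(** The divisor of x_j is linearly equivalent to the sum of those of y_j and
    x_(d+1). *)
Lemma cycle_lo (b : one_cycle B) j : b (X (lo j)) = b (Y j) + b (X ord_max).
Proof.
rewrite -!inter_ray -raddfD; apply/eqP; rewrite -subr_eq0 -raddfB; apply/eqP.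
apply: inter_principal; apply: principal_Btilde => [l|].
  rewrite !ffunE !eqXX !eqYY lo_max.
  rewrite (inj_eq lo_inj) !eqYX !eqXY.
  by case: (l == j).
under eq_bigr do rewrite !ffunE !eqXX !eqXY add0r.
by rewrite sumrB !ind subrr.
Qed.

(** A curve negative on the divisor of x_(d+1) would be negative on all the
    linearly equivalent ones, and x_(n+1), ..., x_(d+1) would span a cone. *)
Lemma curve_high_ge0 (b : one_cycle B) : curve_class b -> 0 <= b (X ord_max).
Proof.
move=> bC; rewrite leNgt; apply/negP => bmax.
have [s sB sP] := curve_class_cone bC (ltr0_neq0 bmax).
by apply: (Btilde_cone_high sB) => i ni; apply: sP; left; rewrite cycle_high.
Qed.

(** If the curve meets y_j in degree 0, use cycle_lo; otherwise negativity on
    x_j would place x_j and y_j in a common cone. *)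
Lemma curve_lo_ge0 (b : one_cycle B) j : curve_class b -> 0 <= b (X (lo j)).
Proof.
move=> bC; have [bY|bY] := eqVneq (b (Y j)) 0.
  by rewrite cycle_lo bY add0r curve_high_ge0.
rewrite leNgt; apply/negP => bX; have [s sB sP] := curve_class_cone bC bY.
by apply: (Btilde_cone_pair sB (j := j)); apply: sP; [left|right].
Qed.

Lemma wall_card (phi : 'I_d.+1 -> ray B) (i k : 'I_d.+1) :
  injective phi -> i != k -> #|phi @: ~: [set i; k]|.+1 = d.
Proof.
move=> phi_inj ik; rewrite card_imset // cardsCs finset.setCK card_ord cards2 ik.
have := n_lt_d; lia.
Qed.

(** The wall is spanned by all the x_i other than x_j and x_(d+1). *)
Lemma fiber_curve j : curve_class (fiber_coef j).
Proof.
have Xinj : injective X by move=> i k [].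
pose t := X @: ~: [set lo j; ord_max].
have Yt l : Y l \in t = false by apply/negP => /imsetP[].
have Xt i : (X i \in t) = (i != lo j) && (i != ord_max).
  by rewrite mem_imset // !inE negb_or.
exists t, (X (lo j)), (Y j); split; [split|split|split|].
- by rewrite Xt eqxx.
- by rewrite Yt.
- by [].
- apply: (Btilde_cone_intro (i := ord_max)) => [l||].
  + by rewrite in_setU1 Yt eqYX.
  + exact: ltnW.
  + by rewrite in_setU1 Xt eqxx andbF orbF eqXX eq_sym lo_max.
- apply: (Btilde_cone_intro (i := ord_max)) => [l||].
  + by rewrite !in_setU1 Yt Xt eqYY eqXY orbF => /eqP ->; rewrite eqxx.
  + exact: ltnW.
  + by rewrite in_setU1 Xt eqXY eqxx andbF.
- by rewrite wall_card // lo_max.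
- by rewrite ffunE eqxx.
- by rewrite ffunE eqxx orbT.
- by move=> rho; rewrite !inE ffunE orbA negb_or => /andP[/negPf ->].
- exact: fiber_rel.
Qed.

(** The wall is spanned by y_1, ..., y_n, x_(n+2), ..., x_d, and the two
    adjacent maximal cones add x_(n+1) and x_(d+1). *)
Lemma high_curve : curve_class high_coef.
Proof.
pose i0 : 'I_d.+1 := inord n.
have i0E : i0 = n :> nat by rewrite inordK // ltnS ltnW.
have i0max : i0 != ord_max by apply/eqP => /(congr1 val); rewrite /= i0E; lia.
(* phi replaces x_j by y_j for j <= n, so that this wall, too, is the image of
   the complement of a pair of indices *)
pose phi (i : 'I_d.+1) : ray B := if insub (val i) is Some j then Y j else X i.
have phi_lo j : phi (lo j) = Y j.
  have jn : (val (lo j) < n)%N by rewrite /= loE.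
  by rewrite /phi (insubT (fun k => (k < n)%N) jn); congr Y; apply: val_inj; rewrite /= loE.
have phi_hi (i : 'I_d.+1) : (n <= i)%N -> phi i = X i.
  by move=> ni; rewrite /phi insubF // ltnNge ni.
have lo_ex (i : 'I_d.+1) : (i < n)%N -> exists j, i = lo j.
  by move=> ni; exists (Ordinal ni); apply: val_inj; rewrite /= loE.
have phi_inj : injective phi.
  move=> i k; have [ni|/lo_ex[j ->]] := leqP n i; have [nk|/lo_ex[l ->]] := leqP n k;
    by rewrite ?phi_lo ?phi_hi // => -[] // ->.
pose t := phi @: ~: [set i0; ord_max].
have Yt l : Y l \in t.
  rewrite -phi_lo mem_imset // !inE negb_or lo_max andbT.
  by apply: contraFneq (lo_lt l) => ->; rewrite i0E.
have Xt i : (X i \in t) = [&& (n <= i)%N, i != i0 & i != ord_max].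
  have [ni|/lo_ex[j ->]] := leqP n i; first by rewrite -phi_hi // mem_imset // !inE negb_or.
  by apply/negP => /imsetP[k _]; have [nk|/lo_ex[l ->]] := leqP n k;
    rewrite ?phi_lo // phi_hi // => -[kj]; move: nk; rewrite -kj lo_lt.
have lo_i0 l : (lo l == i0) = false.
  by apply: contraFF (lo_lt l) => /eqP ->; rewrite i0E.
exists t, (X i0), (X ord_max); split; [split|split|split|].
- by rewrite Xt eqxx andbF.
- by rewrite Xt eqxx !andbF.
- by [].
- apply: (Btilde_cone_intro (i := ord_max)) => [l _||].
  + by rewrite in_setU1 Xt eqXX lo_i0 lo_lt.
  + exact: ltnW.
  + by rewrite in_setU1 Xt eqXX eqxx !andbF orbF eq_sym.
- apply: (Btilde_cone_intro (i := i0)) => [l _||]; rewrite ?i0E //.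
  + by rewrite in_setU1 Xt eqXX lo_max lo_lt.
  + by rewrite in_setU1 Xt eqXX eqxx /= andbF orbF.
- by rewrite wall_card.
- by rewrite ffunE /= i0E leqnn.
- by rewrite ffunE /= ltnW.
- case=> [i|j]; rewrite !in_setU1; last by rewrite -/(Y j) Yt !orbT.
  rewrite -/(X i) Xt !eqXX ffunE /=.
  by case: (n <= i)%N; case: (i == i0); case: (i == ord_max).
- exact: high_rel.
Qed.

Lemma Btilde_dual_nef_basis : dual_nef_basis Btilde_cycle Btilde_nef.
Proof.
split.
- by case=> [j|]; [exact: fiber_curve|exact: high_curve].
- by case=> [j|] b bC; rewrite deg_ray; [exact: curve_lo_ge0|exact: curve_high_ge0].
- case=> [j|] [l|]; rewrite deg_ray /= ffunE ?eqXX ?orbF.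
  + by rewrite (inj_eq lo_inj) eq_sym.
  + by rewrite eq_sym lo_max.
  + by rewrite /= lo_lt.
  + by rewrite /= ltnW.
- move=> K c; rewrite -(cls_repr c); set D := repr c => D0.
  have interE b : inter b D = \sum_rho D rho *~ b rho.
    by apply: eq_bigr => rho _; rewrite mulrzr.
  rewrite -[0](raddf0 cls); apply/cls_eq; rewrite subr0.
  have DXY j : D (X (lo j)) + D (Y j) = 0.
    by have := D0 (Some j); rewrite deg_cls interE sum_fiber.
  apply: principal_Btilde => //.
  apply: etrans (D0 None); rewrite (sum_low_high (fun i => D (X i))) deg_cls interE sum_high addrC.
  congr (_ + _); rewrite -sumrN; apply: eq_bigr => j _.
  by apply/eqP; rewrite -addr_eq0 DXY.
Qed.

Lemma deg_antiK_fiber j : deg (Btilde_cycle (Some j)) (antiK B) = 2.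
Proof.
rewrite deg_cls /inter; under eq_bigr do rewrite ffunE mul1r intz.
by rewrite -[RHS](sum_fiber (fun=> 1 : int) j); apply: eq_bigr => rho _; rewrite intz.
Qed.

Lemma deg_antiK_high :
  deg (Btilde_cycle None) (antiK B) = (d.+1%:R - n%:R) - n%:R.
Proof.
rewrite deg_cls /inter; under eq_bigr do rewrite ffunE mul1r intz.
transitivity (\sum_rho (1 : int) *~ high_coef rho).
  by apply: eq_bigr => rho _; rewrite intz.
rewrite (sum_high (fun=> 1)).
have := sum_low_high (fun=> 1 : int); rewrite !sumr_const !card_ord => ->.
by rewrite [X in _ = X - _ - _]addrC addrK.
Qed.

Lemma total_deg_antiK : total_deg Btilde_cycle (antiK B) = d.+1%:R.
Proof.
rewrite /total_deg (bigD1 None) //= deg_antiK_high.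
rewrite (reindex_omap Some id) => [|[]] //=.
under eq_bigr do rewrite deg_antiK_fiber.
rewrite (eq_bigl xpredT) => [|j]; last by rewrite eqxx.
by rewrite sumr_const card_ord -[2 *+ n]mulr_natr; ring.
Qed.

Lemma antiK_nef (R : realType) : NefPic R (antiK B).
Proof.
apply/(NefPicE Btilde_dual_nef_basis) => -[j|]; first by rewrite deg_antiK_fiber.
by rewrite deg_antiK_high; lia.
Qed.

Lemma antiK_neq0 : antiK B != 0.
Proof.
apply/eqP => K0; have := total_deg_antiK; rewrite K0 /total_deg big1 => [|k _].
  by lia.
by rewrite raddf0.
Qed.

End BtildeNef.

Theorem proposition5p1 (R : realType) (d n : nat)
    (d_ge3 : (3 <= d)%N) (n_bounds : (2 <= n <= d.+1)%N) (dn : (2 * n - 1 < d)%N)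
    (x : 'I_d.+1 -> 'rV[int]_d)
    (x_basis : Z_basis (fun i : 'I_d => x (widen_ord (leqnSn d) i)))
    (x_sum : \sum_i x i = 0) :
  let X := Btilde dn x_basis x_sum R in
  [/\ unimodular (baseK R : Pic X -> PicK X R) (Nef X R),
      forall D : Pic X, D != 0 -> NefPic R D -> delta R D = 0%E,
      antiK X != 0 /\ NefPic R (antiK X) &
      tauZ R (antiK X) = tauQ R (antiK X) /\ tauQ R (antiK X) = (d.+1%:R : R)%:E].
Proof.
have basis := Btilde_dual_nef_basis dn x_basis x_sum.
have Knef := antiK_nef dn x_basis x_sum R.
move=> X; split.
- exact: unimodular_Nef basis R.
- move=> D _ /(tau_nef basis)[DZ DQ].
  by rewrite /delta DZ DQ subee.
- by split; [exact: antiK_neq0 dn x_sum|exact: Knef].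
- have [KZ KQ] := tau_nef basis Knef.
  split; first by rewrite KZ KQ.
  by rewrite KQ total_deg_antiK // natz.
Qed.
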